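(* Let $\Omega\subset\mathbb{R}^2$ be a domain, let $p$ and $q$ be complex valued functions on $\Omega$ with $p\in C^2(\Omega)$ and $p\neq0$ in $\Omega$, and let $u_0$ be a nonvanishing (twice continuously differentiable, complex valued) solution in $\Omega$ of the equation $$(\operatorname{div}p\operatorname{grad}+q)u=0 .$$ Set $f=p^{1/2}u_0$. Then for any complex valued (scalar) twice continuously differentiable function $\varphi$ on $\Omega$ the following equality holds: $$\frac14(\operatorname{div}p\operatorname{grad}+q)\varphi=p^{1/2}\left(\partial_z+\frac{f_{\overline z}}{f}C\right)\left(\partial_{\overline z}-\frac{f_{\overline z}}{f}C\right)\left(p^{1/2}\varphi\right).$$
   Context: Bicomplex numbers are elements $Q_1+Q_2k$ with $Q_1,Q_2\in\mathbb{C}=\{a+ib:a,b\in\mathbb{R}\}$, where $i^2=k^2=-1$ and $ik=ki$ (a commutative algebra). A bicomplex number with $Q_2=0$ is called scalar (a usual complex number). The conjugation operator is $C(Q_1+Q_2k)=Q_1-Q_2k$. With real variables $x,y$ and $z=x+ky$, put $\partial_{\overline z}=\frac12(\partial_x+k\partial_y)$, $\partial_z=\frac12(\partial_x-k\partial_y)$, acting on bicomplex valued functions; $f_{\overline z}=\partial_{\overline z}f$. In the operators, $\frac{f_{\overline z}}{f}C$ means: first conjugate, then multiply by $f_{\overline z}/f$. The operator $\operatorname{div}p\operatorname{grad}+q$ acts by $\varphi\mapsto\operatorname{div}(p\operatorname{grad}\varphi)+q\varphi$. $p^{1/2}$ denotes one fixed twice continuously differentiable function on $\Omega$ whose square is $p$,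 the same in all occurrences. *)

(* Defs.v *)
From Stdlib Require Import Reals.
From Coquelicot Require Import Coquelicot.

Open Scope C_scope.

(** * Domains of the plane *)

Definition plane_connected (D : R * R -> Prop) : Prop :=
  forall U V : R * R -> Prop,
    open U -> open V ->
    (forall P, D P -> U P \/ V P) ->
    (exists P, D P /\ U P) ->
    (exists P, D P /\ V P) ->
    exists P, D P /\ U P /\ V P.

Definition plane_domain (D : R * R -> Prop) : Prop :=
  (exists P, D P) /\ open D /\ plane_connected D.

(** * Complex valued functions of two real variables

    Functions on a domain [D] are total functions on [R * R] of which only the
    values on [D] matter: [D] is open, so partial derivatives at a point of [D]
    are determined by these values. *)

Definition ex_pdx (f : R * R -> C) (P : R * R) : Prop :=
  ex_derive (V := C_R_NormedModule) (fun t : R => f (t, snd P)) (fst P).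

Definition ex_pdy (f : R * R -> C) (P : R * R) : Prop :=
  ex_derive (V := C_R_NormedModule) (fun t : R => f (fst P, t)) (snd P).

(** Coquelicot's [Derive] is restricted to real valued functions, hence the
    splitting into real and imaginary parts; see [pdx_correct], [pdy_correct]. *)

Definition pdx (f : R * R -> C) (P : R * R) : C :=
  (Derive (fun t : R => Re (f (t, snd P))) (fst P),
   Derive (fun t : R => Im (f (t, snd P))) (fst P)).

Definition pdy (f : R * R -> C) (P : R * R) : C :=
  (Derive (fun t : R => Re (f (fst P, t))) (snd P),
   Derive (fun t : R => Im (f (fst P, t))) (snd P)).

Lemma is_derive_C_Re_Im (g : R -> C) (x : R) (l : C) :
  is_derive (V := C_R_NormedModule) g x l ->
  is_derive (fun t => Re (g t)) x (Re l) /\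
  is_derive (fun t => Im (g t)) x (Im l).
Proof.
intros H; split.
- apply (filterdiff_ext_lin _ (fun y : R => fst (scal (V := C_R_NormedModule) y l))).
  + apply (filterdiff_comp g (fst : C -> R) _ fst H).
    apply filterdiff_linear, is_linear_fst.
  + reflexivity.
- apply (filterdiff_ext_lin _ (fun y : R => snd (scal (V := C_R_NormedModule) y l))).
  + apply (filterdiff_comp g (snd : C -> R) _ snd H).
    apply filterdiff_linear, is_linear_snd.
  + reflexivity.
Qed.

Lemma pdx_correct (f : R * R -> C) (P : R * R) (l : C) :
  is_derive (V := C_R_NormedModule) (fun t : R => f (t, snd P)) (fst P) l ->
  pdx f P = l.
Proof.
intros H; destruct (is_derive_C_Re_Im _ _ _ H) as [H1 H2].
apply injective_projections; apply is_derive_unique; assumption.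
Qed.

Lemma pdy_correct (f : R * R -> C) (P : R * R) (l : C) :
  is_derive (V := C_R_NormedModule) (fun t : R => f (fst P, t)) (snd P) l ->
  pdy f P = l.
Proof.
intros H; destruct (is_derive_C_Re_Im _ _ _ H) as [H1 H2].
apply injective_projections; apply is_derive_unique; assumption.
Qed.

(** [f] is [n] times continuously differentiable on [D]. *)
Fixpoint Cn (n : nat) (D : R * R -> Prop) (f : R * R -> C) : Prop :=
  (forall P, D P -> continuous f P) /\
  match n with
  | O => True
  | S m =>
      (forall P, D P -> ex_pdx f P /\ ex_pdy f P) /\
      Cn m D (pdx f) /\ Cn m D (pdy f)
  end.

Definition grad (u : R * R -> C) (P : R * R) : C * C := (pdx u P, pdy u P).

Definition div (V : R * R -> C * C) (P : R * R) : C :=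
  pdx (fun Q => fst (V Q)) P + pdy (fun Q => snd (V Q)) P.

(** The operator [div p grad + q]. *)
Definition div_grad_op (p q u : R * R -> C) (P : R * R) : C :=
  div (fun Q => (p Q * fst (grad u Q), p Q * snd (grad u Q))) P + q P * u P.

(** * Bicomplex numbers *)

(** [Bicomplex Q1 Q2] is [Q1 + Q2 k]; [C] carries the imaginary unit [i]. *)
Record bicomplex : Set := Bicomplex { bsc : C; bvec : C }.

Definition bc_of_C (a : C) : bicomplex := Bicomplex a 0.
Definition bk : bicomplex := Bicomplex 0 1.

Definition badd (V W : bicomplex) : bicomplex :=
  Bicomplex (bsc V + bsc W) (bvec V + bvec W).
Definition bopp (W : bicomplex) : bicomplex := Bicomplex (- bsc W) (- bvec W).
Definition bsub (V W : bicomplex) : bicomplex := badd V (bopp W).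
Definition bmul (V W : bicomplex) : bicomplex :=
  Bicomplex (bsc V * bsc W - bvec V * bvec W)
            (bsc V * bvec W + bvec V * bsc W).
Definition bconj (W : bicomplex) : bicomplex := Bicomplex (bsc W) (- bvec W).

Declare Scope bicomplex_scope.
Delimit Scope bicomplex_scope with BC.
Bind Scope bicomplex_scope with bicomplex.
Infix "+" := badd : bicomplex_scope.
Infix "-" := bsub : bicomplex_scope.
Infix "*" := bmul : bicomplex_scope.
Notation "- W" := (bopp W) : bicomplex_scope.

Lemma bicomplex_ring_theory :
  ring_theory (bc_of_C 0) (bc_of_C 1) badd bmul bsub bopp eq.
Proof.
split; intros; repeat match goal with W : bicomplex |- _ => destruct W end;
  unfold bsub, badd, bopp, bmul, bc_of_C; cbn [bsc bvec];
  try reflexivity; f_equal; ring.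
Qed.

Lemma bk_square : (bk * bk)%BC = (- bc_of_C 1)%BC.
Proof. unfold bk, bmul, bopp, bc_of_C; cbn [bsc bvec]; f_equal; ring. Qed.

(** * Bicomplex valued functions *)

Definition bpdx (W : R * R -> bicomplex) (P : R * R) : bicomplex :=
  Bicomplex (pdx (fun Q => bsc (W Q)) P) (pdx (fun Q => bvec (W Q)) P).

Definition bpdy (W : R * R -> bicomplex) (P : R * R) : bicomplex :=
  Bicomplex (pdy (fun Q => bsc (W Q)) P) (pdy (fun Q => bvec (W Q)) P).

Definition dzbar (W : R * R -> bicomplex) (P : R * R) : bicomplex :=
  (bc_of_C (RtoC (/ 2)) * (bpdx W P + bk * bpdy W P))%BC.

Definition dz (W : R * R -> bicomplex) (P : R * R) : bicomplex :=
  (bc_of_C (RtoC (/ 2)) * (bpdx W P - bk * bpdy W P))%BC.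

Definition scalar (g : R * R -> C) (P : R * R) : bicomplex := bc_of_C (g P).

(** [f_zbar / f] for a scalar function [f]. *)
Definition dzbar_quot (f : R * R -> C) (P : R * R) : bicomplex :=
  (dzbar (scalar f) P * bc_of_C (/ f P))%BC.

(** [dz + a C] and [dzbar - a C], where [a C] conjugates first and then
    multiplies by [a]. *)
Definition dz_plus_C (a W : R * R -> bicomplex) (P : R * R) : bicomplex :=
  (dz W P + a P * bconj (W P))%BC.

Definition dzbar_minus_C (a W : R * R -> bicomplex) (P : R * R) : bicomplex :=
  (dzbar W P - a P * bconj (W P))%BC.

(* Main.v *)
Require Import Defs.
From Stdlib Require Import Reals Psatz.
From Coquelicot Require Import Coquelicot.

Local Open Scope C_scope.

(** Write [s] for the square root of [p], [f = s u0], [w = s phi] and [L] for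
    the Laplacian.  Two computations give the theorem.

    Liouville substitution ([div_grad_op_sqrt]): since [p = s^2], one has
    [(div p grad + q) phi = s (L w - phi L s) + q phi].  Applied to [u0], whose
    image is zero, the same formula gives [q = - s (L f - u0 L s) / u0].
    Substituting this [q] makes [L s] disappear:
    [(div p grad + q) phi = s (L w - (L f / f) w)].

    Factorization ([schroedinger_factorization]): put [a = f_zbar / f].  The
    components of [W = (dzbar - a C) w] along [1] and [k] are half of
    [w_x - (f_x / f) w] and half of [w_y - (f_y / f) w].  In [(dz + a C) W] the
    first order terms cancel, the part along [k] vanishes because
    [w_xy = w_yx] and [f_xy = f_yx], and what remains is a quarter of
    [L w - (L f / f) w].

    Schwarz's theorem is needed only for [s], [u0] and [phi]
    ([Cn2_twice_diff]); the symmetry of the mixed derivatives of [f] and [w]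
    then follows from the Leibniz rule ([twice_diff_mult]). *)

(** * Curves in the complex plane *)

Lemma is_derive_C_pair (g : R -> C) (t : R) (l : C) :
  is_derive (fun r => Re (g r)) t (Re l) ->
  is_derive (fun r => Im (g r)) t (Im l) ->
  is_derive (V := C_R_NormedModule) g t l.
Proof.
intros H1 H2.
apply (is_derive_ext (V := C_R_NormedModule) (fun r => (Re (g r), Im (g r)))).
{ intros r; symmetry; apply surjective_pairing. }
apply (filterdiff_ext_lin (V := C_R_NormedModule) _
         (fun y : R => (scal y (Re l), scal y (Im l)))).
- apply (filterdiff_comp'_2 (W := C_R_NormedModule)
           (fun r => Re (g r)) (fun r => Im (g r)) (fun a b => (a, b)) t
           (fun y : R => scal y (Re l)) (fun y : R => scal y (Im l))
           (fun a b => (a, b)) H1 H2).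
  apply filterdiff_linear, is_linear_prod;
    [apply is_linear_fst | apply is_linear_snd].
- reflexivity.
Qed.

Lemma is_derive_Cminus (g h : R -> C) (t : R) (g' h' : C) :
  is_derive (V := C_R_NormedModule) g t g' ->
  is_derive (V := C_R_NormedModule) h t h' ->
  is_derive (V := C_R_NormedModule) (fun r => g r - h r) t (g' - h').
Proof. exact (is_derive_minus (V := C_R_NormedModule) g h t g' h'). Qed.

Lemma is_derive_Cplus (g h : R -> C) (t : R) (g' h' : C) :
  is_derive (V := C_R_NormedModule) g t g' ->
  is_derive (V := C_R_NormedModule) h t h' ->
  is_derive (V := C_R_NormedModule) (fun r => g r + h r) t (g' + h').
Proof. exact (is_derive_plus (V := C_R_NormedModule) g h t g' h'). Qed.

Lemma is_derive_Cmult (g h : R -> C) (t : R) (g' h' : C) :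
  is_derive (V := C_R_NormedModule) g t g' ->
  is_derive (V := C_R_NormedModule) h t h' ->
  is_derive (V := C_R_NormedModule) (fun r => g r * h r) t
    (g' * h t + g t * h').
Proof.
intros Hg Hh.
destruct (is_derive_C_Re_Im _ _ _ Hg) as [Hg1 Hg2].
destruct (is_derive_C_Re_Im _ _ _ Hh) as [Hh1 Hh2].
apply is_derive_C_pair; unfold Re, Im in *; cbn [Cmult Cplus fst snd].
- evar_last.
  + apply (is_derive_minus (V := R_NormedModule));
      (apply (is_derive_mult (K := R_AbsRing));
         [eassumption | eassumption | exact Rmult_comm]).
  + unfold minus, plus, opp, mult; simpl; ring.
- evar_last.
  + apply (is_derive_plus (V := R_NormedModule));
      (apply (is_derive_mult (K := R_AbsRing));
         [eassumption | eassumption | exact Rmult_comm]).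
  + unfold plus, mult; simpl; ring.
Qed.

Lemma is_derive_Cinv (g : R -> C) (t : R) (g' : C) :
  g t <> RtoC 0 ->
  is_derive (V := C_R_NormedModule) g t g' ->
  is_derive (V := C_R_NormedModule) (fun r => / g r) t
    (- (g' * / g t * / g t)).
Proof.
intros H0 Hg.
destruct (is_derive_C_Re_Im _ _ _ Hg) as [Hg1 Hg2].
assert (Hn : (fst (g t) ^ 2 + snd (g t) ^ 2)%R <> 0%R).
{ intros E; apply H0.
  destruct (g t) as [a b]; cbn [fst snd] in E.
  assert (a = 0%R) by nra. assert (b = 0%R) by nra. now subst. }
unfold Re, Im in Hg1, Hg2.
set (a := fun r => fst (g r)) in *; set (b := fun r => snd (g r)) in *.
change (fst (g t)) with (a t) in Hn; change (snd (g t)) with (b t) in Hn.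
assert (E1 := is_derive_unique _ _ _ Hg1).
assert (E2 := is_derive_unique _ _ _ Hg2).
assert (X1 : ex_derive a t) by (eexists; exact Hg1).
assert (X2 : ex_derive b t) by (eexists; exact Hg2).
apply is_derive_C_pair; unfold Re, Im; cbn [Cinv Cmult Copp fst snd].
(* The inverse of [a + i b] is [(a - i b) / (a ^ 2 + b ^ 2)]. *)
- change (is_derive (fun r : R => a r / (a r ^ 2 + b r ^ 2))%R t
    (- ((fst g' * (a t / (a t ^ 2 + b t ^ 2))
         - snd g' * (- b t / (a t ^ 2 + b t ^ 2)))
        * (a t / (a t ^ 2 + b t ^ 2))
        - (fst g' * (- b t / (a t ^ 2 + b t ^ 2))
           + snd g' * (a t / (a t ^ 2 + b t ^ 2)))
        * (- b t / (a t ^ 2 + b t ^ 2))))%R).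
  auto_derive; [now repeat split |].
  replace (Derive (fun x => a x) t) with (fst g') by (symmetry; exact E1).
  replace (Derive (fun x => b x) t) with (snd g') by (symmetry; exact E2).
  field; exact Hn.
- change (is_derive (fun r : R => - b r / (a r ^ 2 + b r ^ 2))%R t
    (- ((fst g' * (a t / (a t ^ 2 + b t ^ 2))
         - snd g' * (- b t / (a t ^ 2 + b t ^ 2)))
        * (- b t / (a t ^ 2 + b t ^ 2))
        + (fst g' * (- b t / (a t ^ 2 + b t ^ 2))
           + snd g' * (a t / (a t ^ 2 + b t ^ 2)))
        * (a t / (a t ^ 2 + b t ^ 2))))%R).
  auto_derive; [now repeat split |].
  replace (Derive (fun x => a x) t) with (fst g') by (symmetry; exact E1).
  replace (Derive (fun x => b x) t) with (snd g') by (symmetry; exact E2).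
  field; exact Hn.
Qed.

(** * Partial derivatives on an open set *)

(** The line through [P] parallel to the [x]-axis ([e = true]) or to the
    [y]-axis ([e = false]), and the parameter of [P] on it. *)
Definition axis_line (e : bool) (P : R * R) (t : R) : R * R :=
  if e then (t, snd P) else (fst P, t).
Definition axis_coord (e : bool) (P : R * R) : R := if e then fst P else snd P.

(** The partial derivative in [x] ([e = true]) or in [y] ([e = false]). *)
Definition pd (e : bool) (f : R * R -> C) : R * R -> C :=
  if e then pdx f else pdy f.

(** At every point of [D] the function [f] has a partial derivative in the
    direction [e], and it is given there by [g]. *)
Definition partial_on (D : R * R -> Prop) (e : bool) (f g : R * R -> C) : Prop :=
  forall P, D P ->
    is_derive (V := C_R_NormedModule)
      (fun t => f (axis_line e P t)) (axis_coord e P) (g P).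

Lemma axis_line_coord (e : bool) (P : R * R) :
  axis_line e P (axis_coord e P) = P.
Proof. destruct e, P; reflexivity. Qed.

Lemma pd_eq (D : R * R -> Prop) (e : bool) (f g : R * R -> C) :
  partial_on D e f g -> forall P, D P -> pd e f P = g P.
Proof.
intros H P HP; specialize (H P HP).
destruct e; [apply pdx_correct | apply pdy_correct]; exact H.
Qed.

Lemma axis_line_locally (D : R * R -> Prop) (e : bool) (P : R * R) :
  open D -> D P -> locally (axis_coord e P) (fun t => D (axis_line e P t)).
Proof.
intros HD HP.
destruct (HD P HP) as [eps Heps]; exists eps; intros t Ht.
apply Heps; destruct e; split; simpl; trivial; apply ball_center.
Qed.

Lemma partial_on_ext (D : R * R -> Prop) (e : bool) (f1 f2 g1 g2 : R * R -> C) :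
  open D ->
  (forall P, D P -> f1 P = f2 P) -> (forall P, D P -> g1 P = g2 P) ->
  partial_on D e f1 g1 -> partial_on D e f2 g2.
Proof.
intros HD Hf Hg H P HP; rewrite <- Hg by assumption.
apply (is_derive_ext_loc (V := C_R_NormedModule)
         (fun t => f1 (axis_line e P t))); [| exact (H P HP)].
generalize (axis_line_locally D e P HD HP); apply filter_imp.
intros t Ht; now apply Hf.
Qed.

Lemma partial_on_const (D : R * R -> Prop) (e : bool) (c : C) :
  partial_on D e (fun _ => c) (fun _ => RtoC 0).
Proof. intros P HP; apply (is_derive_const (V := C_R_NormedModule)). Qed.

Lemma partial_on_plus (D : R * R -> Prop) (e : bool) (f f' g g' : R * R -> C) :
  partial_on D e f f' -> partial_on D e g g' ->
  partial_on D e (fun P => f P + g P) (fun P => f' P + g' P).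
Proof. intros Hf Hg P HP; apply is_derive_Cplus; auto. Qed.

Lemma partial_on_minus (D : R * R -> Prop) (e : bool) (f f' g g' : R * R -> C) :
  partial_on D e f f' -> partial_on D e g g' ->
  partial_on D e (fun P => f P - g P) (fun P => f' P - g' P).
Proof. intros Hf Hg P HP; apply is_derive_Cminus; auto. Qed.

Lemma partial_on_mult (D : R * R -> Prop) (e : bool) (f f' g g' : R * R -> C) :
  partial_on D e f f' -> partial_on D e g g' ->
  partial_on D e (fun P => f P * g P) (fun P => f' P * g P + f P * g' P).
Proof.
intros Hf Hg P HP.
assert (H := is_derive_Cmult _ _ _ _ _ (Hf P HP) (Hg P HP)).
cbv beta in H; rewrite !axis_line_coord in H; exact H.
Qed.

Lemma partial_on_inv (D : R * R -> Prop) (e : bool) (f f' : R * R -> C) :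
  (forall P, D P -> f P <> RtoC 0) -> partial_on D e f f' ->
  partial_on D e (fun P => / f P) (fun P => - (f' P * / f P * / f P)).
Proof.
intros H0 Hf P HP.
assert (Hne : f (axis_line e P (axis_coord e P)) <> RtoC 0)
  by (rewrite axis_line_coord; auto).
assert (H := is_derive_Cinv (fun t => f (axis_line e P t)) _ _ Hne (Hf P HP)).
cbv beta in H; rewrite !axis_line_coord in H; exact H.
Qed.

(** * Functions with symmetric second derivatives *)

(** [g] has all partial derivatives of order at most two on [D], and the mixed
    ones agree.  Unlike twice continuous differentiability, this is stable
    under products by the Leibniz rule alone, without any continuity
    argument. *)
Definition twice_diff (D : R * R -> Prop) (g : R * R -> C) : Prop :=
  (forall e, partial_on D e g (pd e g)) /\
  (forall e e', partial_on D e' (pd e g) (pd e' (pd e g))) /\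
  (forall P, D P -> pdx (pdy g) P = pdy (pdx g) P).

Lemma ex_partial_on (D : R * R -> Prop) (g : R * R -> C) :
  (forall P, D P -> ex_pdx g P /\ ex_pdy g P) ->
  forall e, partial_on D e g (pd e g).
Proof.
intros H e P HP; destruct (H P HP) as [[lx Hx] [ly Hy]]; destruct e.
- simpl; rewrite (pdx_correct _ _ _ Hx); exact Hx.
- simpl; rewrite (pdy_correct _ _ _ Hy); exact Hy.
Qed.

Lemma continuity_2d_Re (h : R * R -> C) (x y : R) :
  continuous h (x, y) -> continuity_2d_pt (fun u v => Re (h (u, v))) x y.
Proof.
intros H; apply continuity_2d_pt_filterlim.
apply filterlim_ext with (fun z : R * R => fst (h z)).
{ intros [u v]; reflexivity. }
apply (continuous_comp h fst (x, y) H).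
destruct (h (x, y)); apply continuous_fst.
Qed.

Lemma continuity_2d_Im (h : R * R -> C) (x y : R) :
  continuous h (x, y) -> continuity_2d_pt (fun u v => Im (h (u, v))) x y.
Proof.
intros H; apply continuity_2d_pt_filterlim.
apply filterlim_ext with (fun z : R * R => snd (h z)).
{ intros [u v]; reflexivity. }
apply (continuous_comp h snd (x, y) H).
destruct (h (x, y)); apply continuous_snd.
Qed.

(** The mixed derivatives agree by Schwarz's theorem, applied to the real and
    imaginary parts. *)
Lemma Cn2_twice_diff (D : R * R -> Prop) (g : R * R -> C) :
  open D -> Cn 2 D g -> twice_diff D g.
Proof.
intros HD (_ & H1 & (_ & Hx1 & (Cxx & _) & (Cyx & _))
                  & (_ & Hy1 & (Cxy & _) & (Cyy & _))).
split; [| split].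
- now apply ex_partial_on.
- intros [|]; now apply ex_partial_on.
- intros [x y] HP.
  assert (L : locally_2d (fun u v => D (u, v)) x y).
  { apply locally_2d_locally; generalize (HD _ HP); apply filter_imp.
    now intros [u v]. }
  assert (E : forall (k : R -> C) (t : R),
    ex_derive (V := C_R_NormedModule) k t ->
    ex_derive (fun r => Re (k r)) t /\ ex_derive (fun r => Im (k r)) t).
  { intros k t [l Hl]; destruct (is_derive_C_Re_Im _ _ _ Hl).
    split; eexists; eassumption. }
  apply injective_projections; simpl; apply Schwarz.
  1, 4: destruct L as [d Hd]; exists d; intros u v Hu Hv;
    specialize (Hd u v Hu Hv);
    destruct (H1 _ Hd) as [G1 G2]; destruct (Hx1 _ Hd) as [_ G3];
    destruct (Hy1 _ Hd) as [G4 _];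
    apply E in G1, G2, G3, G4;
    repeat split; [apply G1 | apply G2 | apply G4 | apply G3].
  + exact (continuity_2d_Re _ _ _ (Cxy _ HP)).
  + exact (continuity_2d_Re _ _ _ (Cyx _ HP)).
  + exact (continuity_2d_Im _ _ _ (Cxy _ HP)).
  + exact (continuity_2d_Im _ _ _ (Cyx _ HP)).
Qed.

Lemma pd_mult (D : R * R -> Prop) (g h : R * R -> C) :
  twice_diff D g -> twice_diff D h ->
  forall e P, D P ->
    pd e (fun Q => g Q * h Q) P = pd e g P * h P + g P * pd e h P.
Proof.
intros [Hg _] [Hh _] e.
now apply (pd_eq D e _ (fun P => pd e g P * h P + g P * pd e h P)),
  partial_on_mult.
Qed.

Lemma partial_on_pd_mult (D : R * R -> Prop) (g h : R * R -> C) :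
  open D -> twice_diff D g -> twice_diff D h ->
  forall e e', partial_on D e' (pd e (fun Q => g Q * h Q))
    (fun P => (pd e' (pd e g) P * h P + pd e g P * pd e' h P)
            + (pd e' g P * pd e h P + g P * pd e' (pd e h) P)).
Proof.
intros HD Hg Hh e e'.
apply (partial_on_ext D e' (fun P => pd e g P * h P + g P * pd e h P) _
         (fun P => (pd e' (pd e g) P * h P + pd e g P * pd e' h P)
            + (pd e' g P * pd e h P + g P * pd e' (pd e h) P)) _ HD).
- intros P HP; symmetry; now apply (pd_mult D).
- reflexivity.
- destruct Hg as (Hg1 & Hg2 & _), Hh as (Hh1 & Hh2 & _).
  apply partial_on_plus; now apply partial_on_mult.
Qed.

Lemma pd2_mult (D : R * R -> Prop) (g h : R * R -> C) :
  open D -> twice_diff D g -> twice_diff D h ->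
  forall e e' P, D P ->
    pd e' (pd e (fun Q => g Q * h Q)) P =
      (pd e' (pd e g) P * h P + pd e g P * pd e' h P)
      + (pd e' g P * pd e h P + g P * pd e' (pd e h) P).
Proof.
intros HD Hg Hh e e' P HP.
now rewrite (pd_eq D e' _ _ (partial_on_pd_mult D g h HD Hg Hh e e') P HP).
Qed.

Lemma twice_diff_mult (D : R * R -> Prop) (g h : R * R -> C) :
  open D -> twice_diff D g -> twice_diff D h ->
  twice_diff D (fun Q => g Q * h Q).
Proof.
intros HD Hg Hh; split; [| split].
- intros e.
  apply (partial_on_ext D e (fun Q => g Q * h Q) _
           (fun P => pd e g P * h P + g P * pd e h P) _ HD); trivial.
  + intros P HP; symmetry; now apply (pd_mult D).
  + now apply partial_on_mult; [apply Hg | apply Hh].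
- intros e e' P HP; rewrite (pd2_mult D) by assumption.
  exact (partial_on_pd_mult D g h HD Hg Hh e e' P HP).
- intros P HP.
  assert (E1 := pd2_mult D g h HD Hg Hh false true P HP).
  assert (E2 := pd2_mult D g h HD Hg Hh true false P HP).
  simpl in E1, E2; rewrite E1, E2.
  destruct Hg as (_ & _ & Sg), Hh as (_ & _ & Sh).
  rewrite (Sg P HP), (Sh P HP); ring.
Qed.

(** * Reduction to an equation without first order terms *)

(** The Laplacian of a complex valued function of two real variables. *)
Definition laplacian (g : R * R -> C) (P : R * R) : C :=
  pdx (pdx g) P + pdy (pdy g) P.

Lemma laplacian_mult (D : R * R -> Prop) (g h : R * R -> C) :
  open D -> twice_diff D g -> twice_diff D h ->
  forall P, D P ->
    laplacian (fun Q => g Q * h Q) P =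
      laplacian g P * h P + (pdx g P * pdx h P + pdx g P * pdx h P)
      + (pdy g P * pdy h P + pdy g P * pdy h P) + g P * laplacian h P.
Proof.
intros HD Hg Hh P HP; unfold laplacian.
assert (E1 := pd2_mult D g h HD Hg Hh true true P HP).
assert (E2 := pd2_mult D g h HD Hg Hh false false P HP).
simpl in E1, E2; rewrite E1, E2; ring.
Qed.

(** With [s] a square root of [p], the substitution [w = s * g] removes the
    first order terms of [div p grad + q]. *)
Lemma div_grad_op_sqrt (D : R * R -> Prop) (p q s g : R * R -> C) :
  open D -> twice_diff D s -> twice_diff D g ->
  (forall P, D P -> s P * s P = p P) ->
  forall P, D P ->
    div_grad_op p q g P =
      s P * (laplacian (fun Q => s Q * g Q) P - laplacian s P * g P) + q P * g P.
Proof.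
intros HD Hs Hg Hp P HP.
assert (E : forall e, pd e (fun Q => p Q * pd e g Q) P =
  (pd e s P * s P + s P * pd e s P) * pd e g P
  + (s P * s P) * pd e (pd e g) P).
{ intros e.
  apply (pd_eq D e _ (fun P => (pd e s P * s P + s P * pd e s P) * pd e g P
           + (s P * s P) * pd e (pd e g) P)); trivial.
  apply (partial_on_ext D e (fun Q => (s Q * s Q) * pd e g Q) _
           (fun P => (pd e s P * s P + s P * pd e s P) * pd e g P
           + (s P * s P) * pd e (pd e g) P) _ HD); trivial.
  - intros Q HQ; now rewrite Hp.
  - apply (partial_on_mult D e (fun Q => s Q * s Q)); [| apply Hg].
    apply partial_on_mult; apply Hs. }
rewrite (laplacian_mult D) by assumption.
assert (E1 := E true); assert (E2 := E false); simpl in E1, E2.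
unfold div_grad_op, div, grad, laplacian; cbn [fst snd].
rewrite E1, E2; ring.
Qed.

(** * Bicomplex factorization of the Schroedinger operator *)

Lemma dzbar_scalar (g : R * R -> C) (P : R * R) :
  dzbar (scalar g) P =
    Bicomplex (RtoC (/ 2) * pdx g P) (RtoC (/ 2) * pdy g P).
Proof.
assert (E : forall e, pd e (fun _ => RtoC 0) P = RtoC 0).
{ intros e; apply (pd_eq (fun _ => True) e _ _
    (partial_on_const (fun _ => True) e (RtoC 0)) P I). }
assert (E1 := E true); assert (E2 := E false); simpl in E1, E2.
unfold dzbar, bpdx, bpdy, scalar, bc_of_C, bk, badd, bmul; cbn [bsc bvec].
rewrite E1, E2.
change (fun Q : R * R => g Q) with g.
f_equal; ring.
Qed.

(** One component of [dzbar w - (f_zbar / f) C w], and its derivative. *)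
Lemma partial_on_component (D : R * R -> Prop) (f w : R * R -> C) :
  open D -> twice_diff D f -> twice_diff D w ->
  (forall P, D P -> f P <> RtoC 0) ->
  forall e e',
    partial_on D e'
      (fun P => RtoC (/ 2) * (pd e w P - pd e f P * / f P * w P))
      (fun P => RtoC (/ 2) *
         (pd e' (pd e w) P
          - (pd e' (pd e f) P * / f P * w P
             - pd e f P * pd e' f P * / f P * / f P * w P
             + pd e f P * / f P * pd e' w P))).
Proof.
intros HD (Hf1 & Hf2 & _) (Hw1 & Hw2 & _) H0 e e'.
assert (H := partial_on_mult D e' _ _ _ _
  (partial_on_const D e' (RtoC (/ 2)))
  (partial_on_minus D e' _ _ _ _ (Hw2 e e')
    (partial_on_mult D e' _ _ _ _
      (partial_on_mult D e' _ _ _ _ (Hf2 e e')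
         (partial_on_inv D e' f _ H0 (Hf1 e'))) (Hw1 e')))).
revert H; apply partial_on_ext; trivial.
intros P HP; cbv beta; ring.
Qed.

(** The operator [w |-> L w - (L f / f) w], where [L] is the
    Laplacian, is four times the product of two first order bicomplex
    operators.  Both sides vanish at [w = f]. *)
Lemma schroedinger_factorization (D : R * R -> Prop) (f w : R * R -> C) :
  open D -> twice_diff D f -> twice_diff D w ->
  (forall P, D P -> f P <> RtoC 0) ->
  forall P, D P ->
    dz_plus_C (dzbar_quot f) (dzbar_minus_C (dzbar_quot f) (scalar w)) P =
    bc_of_C (RtoC (/ 4) * (laplacian w P - laplacian f P * / f P * w P)).
Proof.
intros HD Hf Hw H0 P HP.
set (comp := fun e Q => RtoC (/ 2) * (pd e w Q - pd e f Q * / f Q * w Q)).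
assert (EW : forall Q, dzbar_minus_C (dzbar_quot f) (scalar w) Q =
  Bicomplex (comp true Q) (comp false Q)).
{ intros Q; unfold dzbar_minus_C, dzbar_quot; rewrite !dzbar_scalar.
  unfold comp, scalar, bconj, bsub, badd, bopp, bmul, bc_of_C, pd;
    cbn [bsc bvec]; f_equal; ring. }
assert (EP : forall e e' : bool, pd e' (fun Q : R * R =>
     (if e then bsc else bvec) (dzbar_minus_C (dzbar_quot f) (scalar w) Q)) P =
   RtoC (/ 2) *
         (pd e' (pd e w) P
          - (pd e' (pd e f) P * / f P * w P
             - pd e f P * pd e' f P * / f P * / f P * w P
             + pd e f P * / f P * pd e' w P))).
{ intros e e'.
  refine (pd_eq D e' _ _ (partial_on_ext D e' _ _ _ _ HD _
    (fun _ _ => eq_refl) (partial_on_component D f w HD Hf Hw H0 e e')) P HP).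
  intros Q _; rewrite EW; now destruct e. }
assert (Exx := EP true true); assert (Exy := EP true false).
assert (Eyx := EP false true); assert (Eyy := EP false false).
clear EP; cbn [pd] in Exx, Exy, Eyx, Eyy.
unfold dz_plus_C, dz, bpdx, bpdy.
rewrite Exx, Exy, Eyx, Eyy, EW.
unfold dzbar_quot; rewrite dzbar_scalar.
destruct Hf as (_ & _ & Sf), Hw as (_ & _ & Sw).
replace (RtoC (/ 4)) with (RtoC (/ 2) * RtoC (/ 2))
  by (rewrite <- RtoC_mult; f_equal; field).
unfold comp, laplacian, bconj, bsub, badd, bopp, bmul, bc_of_C, bk, pd;
  cbn [bsc bvec].
rewrite (Sf P HP), (Sw P HP).
f_equal; ring.
Qed.

Theorem theorem3 (Omega : R * R -> Prop) (p q u0 sqrtp : R * R -> C)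
  (hOmega : plane_domain Omega)
  (hp : Cn 2 Omega p)
  (hp0 : forall P, Omega P -> p P <> RtoC 0)
  (hsqrtp : Cn 2 Omega sqrtp)
  (hsqrtp_sq : forall P, Omega P -> Cmult (sqrtp P) (sqrtp P) = p P)
  (hu0 : Cn 2 Omega u0)
  (hu0_nz : forall P, Omega P -> u0 P <> RtoC 0)
  (hu0_sol : forall P, Omega P -> div_grad_op p q u0 P = RtoC 0) :
  let f : R * R -> C := fun P => Cmult (sqrtp P) (u0 P) in
  forall phi : R * R -> C, Cn 2 Omega phi ->
  forall P, Omega P ->
    bc_of_C (Cmult (RtoC (/ 4)) (div_grad_op p q phi P)) =
    bmul (bc_of_C (sqrtp P))
      (dz_plus_C (dzbar_quot f)
         (dzbar_minus_C (dzbar_quot f)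
            (scalar (fun Q => Cmult (sqrtp Q) (phi Q)))) P).
Proof.
intros f phi hphi P HP.
destruct hOmega as (_ & HD & _).
assert (Hs := Cn2_twice_diff _ _ HD hsqrtp).
assert (Hu := Cn2_twice_diff _ _ HD hu0).
assert (Hphi := Cn2_twice_diff _ _ HD hphi).
assert (s_nz : forall Q, Omega Q -> sqrtp Q <> RtoC 0).
{ intros Q HQ E; apply (hp0 Q HQ).
  rewrite <- hsqrtp_sq, E by assumption; ring. }
rewrite (schroedinger_factorization Omega f); trivial.
2, 3: now apply twice_diff_mult.
2: { intros Q HQ; apply Cmult_neq_0; auto. }
assert (Hsol := hu0_sol P HP).
rewrite (div_grad_op_sqrt Omega p q sqrtp) in Hsol |- * by assumption.
fold f in Hsol; change (f P) with (sqrtp P * u0 P).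
set (Lf := laplacian f P) in *; set (Ls := laplacian sqrtp P) in *.
set (Lw := laplacian _ P).
(* The equation for [u0] expresses [q] through the Laplacians of [f] and of
   [sqrtp]. *)
assert (Hq : q P = - (sqrtp P * (Lf - Ls * u0 P)) * / u0 P).
{ transitivity ((sqrtp P * (Lf - Ls * u0 P) + q P * u0 P
                 - sqrtp P * (Lf - Ls * u0 P)) * / u0 P).
  - field; auto.
  - rewrite Hsol; field; auto. }
rewrite Hq.
unfold bmul, bc_of_C; cbn [bsc bvec]; f_equal; field; auto.
Qed.
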